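(* Let $T\ge 1$, $\delta\in(0,1)$ and $\delta_t=\frac{6\delta}{\pi^2t^2}$. Let $f:\mathcal X\times\mathcal S\to\mathbb R$ be uniformly bounded, i.e. there is a constant $G>0$ with $|f(x,s)|\le G$ for all $(x,s)\in\mathcal X\times\mathcal S$. Let $h(T)$ be a (deterministic) number such that, with probability at least $1-\delta$, $$\sum_{t=1}^{T}\tfrac12\|p_t-q_t\|^2\le h(T)\quad\text{for all choices of } p_t\in\mathcal P_{t-1},\ q_t\in\mathcal P_t,\ t=1,\dots,T.$$ Let $\eta:=\sqrt{\frac{2h(T)}{G^2T|\mathcal S|}}$. Then the output $(x_1,\dots,x_T)$ of the algorithm ''DRO over Time with Online Projected Gradient Descent'' run with step size $\eta$ on the ambiguity sets $\mathcal P_0,\mathcal P_1,\dots,\mathcal P_T$ (constructed with confidence levels $\delta_t$) satisfies, with probability at least $1-\delta$, $$\frac1T\sum_{t=1}^{T}\Big(\max_{p\in\mathcal P_t}\mathbb E_{s\sim p}[f(x_t,s)]-\min_{x\in\mathcal X}\max_{p\in\mathcal P_t}\mathbb E_{s\sim p}[f(x,s)]\Big)\le G\sqrt{\frac{2|\mathcal S|h(T)}{T}}+\frac{2G}{T}.$$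
   Context: Scenarios: $\mathcal S=\{s_1,\dots,s_{|\mathcal S|}\}$ is a finite set, $\mathcal X$ is the feasible set, and $\mathcal P_0=\{p\in[0,1]^{|\mathcal S|}:\sum_k p_k=1\}$ is the probability simplex. For $p\in\mathcal P_0$, $\mathbb E_{s\sim p}[f(x,s)]=\sum_{k}f(x,s_k)p_k$. $\|\cdot\|$ is the Euclidean norm. $p^*\in\mathcal P_0$ is the true distribution; i.i.d. scenarios are drawn from $p^*$, one per round, and $\hat p_t$ is the empirical distribution of the first $t$ observations. Ambiguity sets: $\mathcal P_0$ is the whole simplex, and for $t\ge1$, $\mathcal P_t$ is of one of the following types (the same type for all $t$), with $\delta_t=\frac{6\delta}{\pi^2t^2}$: (1) confidence intervals: $\mathcal P_t=\{p\in\mathcal P_0: l_t\le p\le u_t\}$ with $l_{kt}=\hat p_{kt}-\frac{z_{\delta_t/2}}{2\sqrt t}$, $u_{kt}=\hat p_{kt}+\frac{z_{\delta_t/2}}{2\sqrt t}$, where $z_{\delta_t/2}$ is the $(1-\frac{\delta_t}{2})$-quantile of the standard normal distribution; (2) $\ell_2$-norm sets: $\mathcal P_t=\{p\in\mathcal P_0:\|p-\hat p_t\|_2\le\epsilon_t\}$ with $\epsilon_t=\sqrt{\frac{2|\mathcal S|\log(2/\delta_t)}{t}}$; (3) kernel based sets: $\mathcal P_t=\{p\in\mathcal P_0:\|p-\hat p_t\|_M\le\epsilon_t\}$ with $\epsilon_t=\frac{\sqrt C}{\sqrt t}\big(2+\sqrt{2\log(1/\delta_t)}\big)$, where $M=(k_M(s_i,s_j))_{i,j}$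 is the (positive definite) matrix of a kernel $k_M:\mathcal S\times\mathcal S\to\mathbb R$ with $k_M(s_i,s_j)\le C$, and $\|q\|_M=\sqrt{q^\top Mq}$. Standing assumption: $\mathbb P(p^*\in\mathcal P_t)\ge1-\delta_t$ for every $t\ge1$. Algorithm (step size $\eta$): put $p_0=(\frac1{|\mathcal S|},\dots,\frac1{|\mathcal S|})$ and $x_0\in\arg\min_{x\in\mathcal X}f(x,s_1)$. For $t=1,\dots,T$: set $\tilde p_t=p_{t-1}+\eta\,\nabla_p\mathbb E_{s\sim p_{t-1}}[f(x_{t-1},s)]$, i.e. $\tilde p_t=p_{t-1}+\eta\,(f(x_{t-1},s_k))_{k=1}^{|\mathcal S|}$; set $p_t=\arg\min_{p\in\mathcal P_{t-1}}\frac12\|p-\tilde p_t\|^2$; choose $x_t\in\arg\min_{x\in\mathcal X}\mathbb E_{s\sim p_t}[f(x,s)]$; then observe the next scenario and form $\mathcal P_t$. All the minima over $\mathcal X$ involved are assumed to be attained. *)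

(* Defs.v *)
From HB Require Import structures.
From mathcomp Require Import all_boot all_order all_algebra finmap.
From mathcomp Require Import all_classical all_reals all_analysis.

Set Implicit Arguments.
Unset Strict Implicit.
Unset Printing Implicit Defensive.

Import Order.TTheory GRing.Theory Num.Theory.

Local Open Scope classical_set_scope.
Local Open Scope ring_scope.

(* "A holds with probability at least a": for measurable A this is
   a <= P A.  Going through a measurable subset gives a meaning to the phrase
   for events that involve arbitrary selections of minimizers, which need not
   depend measurably on the sample path. *)
Definition with_prob_ge (d : measure_display) (Omega : measurableType d)
    (R : realType) (P : probability Omega R) (a : R) (A : set Omega) : Prop :=
  exists E : set Omega, [/\ measurable E, E `<=` A & (a%:E <= P E)%E].

Definition is_argmin (R : realType) (V : Type) (D : set V) (g : V -> R)
    (x : V) : Prop :=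
  D x /\ (forall y, D y -> g x <= g y).

Section Vectors.
Context (R : realType) (S : finType).
Implicit Types (p q v : {ffun S -> R}).

(* The norms on finite powers provided by the library are sup norms. *)
Definition norm2 v : R := Num.sqrt (\sum_s v s ^+ 2).

Definition quad_form (M : S -> S -> R) v : R :=
  \sum_s \sum_s' v s * M s s' * v s'.

Definition normM (M : S -> S -> R) v : R := Num.sqrt (quad_form M v).

Definition posdef_kernel (M : S -> S -> R) : Prop :=
  (forall s s', M s s' = M s' s) /\ (forall v, v != 0 -> 0 < quad_form M v).

Definition simplex : set {ffun S -> R} :=
  [set p | (forall s, 0 <= p s <= 1) /\ \sum_s p s = 1].

Definition expect p (g : S -> R) : R := \sum_s g s * p s.

Definition uniform_dist : {ffun S -> R} := [ffun=> #|S|%:R^-1].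

End Vectors.

Arguments simplex : clear implicits.
Arguments uniform_dist : clear implicits.

Definition std_normal_quantile (R : realType) (a : R) : R :=
  inf [set x : R | (a%:E <= normal_prob 0 1 `]-oo, x])%E].

Definition conf_level (R : realType) (delta : R) (t : nat) : R :=
  6 * delta / (pi ^+ 2 * t%:R ^+ 2).

(* The scenario observed in round i.+1 is obs i. *)
Definition empirical (R : realType) (S : finType) (obs : nat -> S) (t : nat) :
    {ffun S -> R} :=
  [ffun s => (\sum_(i < t) (obs i == s)%:R) / t%:R].

Inductive ambiguity_type (R : realType) (S : finType) : Type :=
| ConfidenceIntervals
| L2Balls
| KernelBalls of (S -> S -> R) & R.

Arguments ConfidenceIntervals {R S}.
Arguments L2Balls {R S}.

Definition wf_ambiguity_type (R : realType) (S : finType)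
    (k : ambiguity_type R S) : Prop :=
  match k with
  | ConfidenceIntervals | L2Balls => True
  | KernelBalls kM C => posdef_kernel kM /\ (forall s s', kM s s' <= C)
  end.

Section AmbiguitySets.
Context (R : realType) (S : finType).

Definition ambiguity_pos (k : ambiguity_type R S) (delta : R)
    (obs : nat -> S) (t : nat) : set {ffun S -> R} :=
  let dt := conf_level delta t in
  let phat := empirical R obs t in
  match k with
  | ConfidenceIntervals =>
      let w := std_normal_quantile (1 - dt / 2) / (2 * Num.sqrt t%:R) in
      [set p | simplex R S p /\
               forall s, phat s - w <= p s <= phat s + w]
  | L2Balls =>
      let eps := Num.sqrt (2 * #|S|%:R * ln (2 / dt) / t%:R) in
      [set p | simplex R S p /\ norm2 (p - phat) <= eps]
  | KernelBalls kM C =>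
      let eps := Num.sqrt C / Num.sqrt t%:R * (2 + Num.sqrt (2 * ln (dt^-1))) in
      [set p | simplex R S p /\ normM kM (p - phat) <= eps]
  end.

Definition ambiguity (k : ambiguity_type R S) (delta : R)
    (obs : nat -> S) (t : nat) : set {ffun S -> R} :=
  if t is 0%N then simplex R S else ambiguity_pos k delta obs t.

End AmbiguitySets.

Definition iid_from (d : measure_display) (Omega : measurableType d)
    (R : realType) (P : probability Omega R) (S : finType)
    (pstar : {ffun S -> R}) (xi : nat -> Omega -> S) : Prop :=
  [/\ forall i (A : set S), measurable (xi i @^-1` A),
      forall i s, P (xi i @^-1` [set s]) = (pstar s)%:E &
      forall (J : {fset nat}) (A : nat -> set S),
        P (\bigcap_(j in [set` J]) (xi j @^-1` A j)) =
        (\prod_(j <- J) P (xi j @^-1` A j))%E].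

Section Algorithm.
Context (R : realType) (S : finType) (V : Type).
Context (X : set V) (f : V -> S -> R).

(* For nonempty compact U (in particular for all ambiguity sets) the supremum
   is a maximum, the objective being linear in p. *)
Definition worst_case (U : set {ffun S -> R}) (x : V) : R :=
  sup [set expect p (f x) | p in U].

(* A true minimum whenever worst_case U attains its minimum over X. *)
Definition robust_value (U : set {ffun S -> R}) : R :=
  inf [set worst_case U x | x in X].

(* Iterates (p_t, x_t), t <= T, of DRO over Time with Online Projected
   Gradient Descent along one sample path with ambiguity sets U t. *)
Definition dro_ogd_run (s1 : S) (eta : R) (U : nat -> set {ffun S -> R})
    (T : nat) (p : nat -> {ffun S -> R}) (x : nat -> V) : Prop :=
  [/\ p 0%N = uniform_dist R S,
      is_argmin X (fun y => f y s1) (x 0%N) &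
      forall t, (1 <= t <= T)%N ->
        let ptilde := p t.-1 + eta *: [ffun s => f (x t.-1) s] in
        is_argmin (U t.-1) (fun q => 1 / 2 * norm2 (q - ptilde) ^+ 2) (p t) /\
        is_argmin X (fun y => expect (p t) (f y)) (x t)].

End Algorithm.

(* Main.v *)
Require Import Defs.
From mathcomp Require Import all_boot all_order all_algebra.
From mathcomp Require Import all_classical all_reals all_analysis.
From mathcomp Require Import ring lra.

(* Fix a sample path on which the drift bound [h T] holds, and let [q_t] be a
   near-maximizer of [E_q f(x_t)] over [U_t].  Since [p_{t+1}] lies in [U_t] and
   [x_{t+1}] is a best response to it, the robust value at [t] is at least
   [E_{p_{t+1}} f(x_{t+1})], so the regret at [t] is at most
   [<f(x_t), q_t - p_t>] plus a telescoping term; Young's inequality with weight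
   [c] turns the sum of the inner products into [h T / c + c T G^2 |S| / 2], and
   [c] is optimized.  At [t = T] a feasible point of [U_T] is needed: the
   empirical distribution is one, because the confidence widths are
   deterministic and some path has [pstar] in [U_T], so they are nonnegative. *)

Set Implicit Arguments.
Unset Strict Implicit.
Unset Printing Implicit Defensive.

Import Order.TTheory GRing.Theory Num.Theory.
Import numFieldNormedType.Exports.

Local Open Scope classical_set_scope.
Local Open Scope ring_scope.

(** * Size of the confidence levels *)

Lemma sin_le_id (R : realType) (x : R) : 0 <= x -> sin x <= x.
Proof.
move=> x0.
have [|c _] := @MVT_segment R sin cos 0 x x0 (fun c _ => is_derive_sin c).
  by apply: continuous_subspaceT; exact: continuous_sin.
rewrite sin0 !subr0 => ->.
by rewrite -[leRHS]mul1r; apply: ler_wpM2r => //; exact: cos_le1.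
Qed.

(** Doubling the angle at [pi / 4] gives [sin (pi / 4) ^+ 2 = 1 / 2]; with [sin x <= x] this yields
    [8 <= pi ^+ 2]. *)
Lemma sqr_pi_gt6 (R : realType) : 6 < (pi : R) ^+ 2.
Proof.
have p0 : 0 <= (pi : R) / 4 by rewrite divr_ge0// pi_ge0.
have s0 : 0 <= sin ((pi : R) / 4).
  by apply: sin_ge0_pi; rewrite p0/=; have := pi_ge0 R; lra.
have : cos ((pi : R) / 4 *+ 2) = 0.
  by rewrite -(cos_pihalf R); congr cos; rewrite -mulr_natr; field.
rewrite cos_mulr2n cos2sin2 => cs.
have : sin ((pi : R) / 4) ^+ 2 <= ((pi : R) / 4) ^+ 2.
  by rewrite lerXn2r ?nnegrE// sin_le_id.
by move: cs; rewrite mulr2n expr_div_n; lra.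
Qed.

(** Makes [1 - conf_level delta t] positive, so that the coverage event for [pstar] contains some
    path. *)
Lemma conf_level_lt1 (R : realType) (delta : R) t :
  0 < delta < 1 -> (0 < t)%N -> conf_level delta t < 1.
Proof.
move=> /andP[d0 d1] t0; rewrite /conf_level.
have t1 : 1 <= (t%:R : R) ^+ 2 by rewrite exprn_ege1// ler1n.
have p6 := sqr_pi_gt6 R.
have pt : 6 < (pi : R) ^+ 2 * t%:R ^+ 2.
  by rewrite (lt_le_trans p6)// ler_peMr// sqr_ge0.
by rewrite ltr_pdivrMr ?mul1r; lra.
Qed.

(** * Feasibility of the empirical distribution *)

Section Empirical.
Context (R : realType) (S : finType).
Implicit Types (obs : nat -> S).

Lemma empirical_simplex obs t : (0 < t)%N -> simplex R S (empirical R obs t).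
Proof.
move=> t0; have tR : 0 < (t%:R : R) by rewrite ltr0n.
split=> [s|].
  rewrite ffunE divr_ge0 ?sumr_ge0//= ler_pdivrMr// mul1r.
  have -> : t%:R = \sum_(i < t) (1 : R) by rewrite sumr_const card_ord.
  by apply: ler_sum => i _; case: eqP.
under eq_bigr do rewrite ffunE.
rewrite -mulr_suml exchange_big/=.
under eq_bigr => i _.
  rewrite (bigD1 (obs i))//= eqxx big1 ?addr0; last first.
    by move=> s /negPf; rewrite eq_sym => ->.
  over.
by rewrite sumr_const card_ord divff// gt_eqF.
Qed.

Lemma ambiguity_simplex k (delta : R) obs t :
  ambiguity k delta obs t `<=` simplex R S.
Proof. by case: t k => [|t] [|| kM C] q //= []. Qed.

(** The width is the same on the paths [obs] and [obs']. For intervals, a feasible point on [obs']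
    gives [- w <= w] at the coordinate [s]; for balls, the radius is nonnegative by its form. *)
Lemma empirical_ambiguity k (delta : R) obs obs' t (s : S) : (0 < t)%N ->
  ambiguity k delta obs' t !=set0 ->
  ambiguity k delta obs t (empirical R obs t).
Proof.
case: t => // t t0 [q].
have sx := empirical_simplex obs t0.
case: k => [|| kM C] /=.
- move=> [_ /(_ s) /andP[l u]]; split=> // s'.
  by move: (le_trans l u) => {l u}; set w := _ / _; lra.
- move=> _; split=> //; rewrite subrr /norm2 big1 ?sqrtr0 ?sqrtr_ge0// => s' _.
  by rewrite ffunE expr0n.
- move=> _; split=> //; rewrite subrr /normM /quad_form big1 ?sqrtr0; last first.
    by move=> s' _; rewrite big1// => s'' _; rewrite ffunE !mul0r.
  by rewrite mulr_ge0 ?divr_ge0 ?addr_ge0 ?sqrtr_ge0.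
Qed.

End Empirical.

Lemma with_prob_ge_nonempty (d : measure_display) (Omega : measurableType d)
    (R : realType) (P : probability Omega R) (a : R) (A : set Omega) :
  0 < a -> with_prob_ge P a A -> A !=set0.
Proof.
move=> a0 [E [_ EA aE]]; have [E0|/set0P[w Ew]] := eqVneq E set0; last by exists w; exact: EA.
by move: aE; rewrite E0 measure0 lee_fin leNgt a0.
Qed.

(** The right side is minimized at [c = sqrt a / sqrt b], where its two terms are equal. *)
Lemma ler_double_sqrt (R : realType) (z a b : R) : 0 <= a -> 0 < b ->
  (forall c, 0 < c -> z <= a / c + c * b) -> z <= 2 * Num.sqrt (a * b).
Proof.
move=> a0 b0 H; have [a_gt0|a_le0] := ltP 0 a.
  have sa : 0 < Num.sqrt a by rewrite sqrtr_gt0.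
  have sb : 0 < Num.sqrt b by rewrite sqrtr_gt0.
  apply: le_trans (H _ (divr_gt0 sa sb)) _.
  have balance (u v : R) : 0 < u -> 0 < v ->
      u ^+ 2 / (u / v) + u / v * v ^+ 2 = 2 * (u * v).
    by move=> u0 v0; field; rewrite !gt_eqF.
  have := balance _ _ sa sb.
  by rewrite !sqr_sqrtr ?(ltW b0)// => ->; rewrite sqrtrM.
have aE : a = 0 by apply/eqP; rewrite eq_le a_le0.
(* For [a = 0] the infimum is only approached as [c] tends to 0, hence the choice [c = e / b]. *)
rewrite aE mul0r sqrtr0 mulr0; apply/ler_addgt0Pr => e e0.
have := H (e / b) (divr_gt0 e0 b0).
by rewrite aE mul0r divfK// gt_eqF.
Qed.

(** * Deterministic regret bound along one sample path *)

Section Regret.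
Context (R : realType) (S : finType).
Implicit Types (g : S -> R) (p q : {ffun S -> R}).

Lemma norm2_sqr p : norm2 p ^+ 2 = \sum_s p s ^+ 2.
Proof. by rewrite sqr_sqrtr// sumr_ge0// => s _; exact: sqr_ge0. Qed.

Lemma expect_bound g G p :
  (forall s, `|g s| <= G) -> simplex R S p -> `|expect p g| <= G.
Proof.
move=> gG [p01 p1]; rewrite -[leRHS]mulr1 -p1 mulr_sumr.
apply: le_trans (ler_norm_sum _ _ _) _; apply: ler_sum => s _.
have /andP[ps _] := p01 s.
by rewrite normrM (ger0_norm ps) ler_wpM2r.
Qed.

(** Young's inequality in each coordinate, whose gap is the square
    [(p s - q s + c * g s) ^+ 2 / (2 * c)]; bounding each [g s ^+ 2] by [G ^+ 2] produces the factor
    [#|S|]. *)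
Lemma expect_young g G p q c : 0 < c -> (forall s, `|g s| <= G) ->
  expect q g - expect p g
    <= (1 / 2 * norm2 (p - q) ^+ 2) / c + c * (G ^+ 2 * #|S|%:R / 2).
Proof.
move=> c0 gG; rewrite norm2_sqr -sumrB.
have -> : (1 / 2 * \sum_s (p - q) s ^+ 2) / c + c * (G ^+ 2 * #|S|%:R / 2) =
    \sum_s ((p - q) s ^+ 2 / (2 * c) + c * (G ^+ 2 / 2)).
  by rewrite big_split/= -mulr_suml sumr_const -mulr_natr; field; rewrite gt_eqF.
apply: ler_sum => s _; rewrite !ffunE.
have gs : g s ^+ 2 <= G ^+ 2.
  by rewrite -[g s ^+ 2]real_normK ?num_real// lerXn2r ?nnegrE// (le_trans _ (gG s)).
apply: (@le_trans _ _ ((p s - q s) ^+ 2 / (2 * c) + c * (g s ^+ 2 / 2))); last first.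
  by rewrite lerD2l ler_pM2l// ler_pM2r.
rewrite -subr_ge0.
have -> : (p s - q s) ^+ 2 / (2 * c) + c * (g s ^+ 2 / 2) - (g s * q s - g s * p s)
    = (p s - q s + c * g s) ^+ 2 / (2 * c) by field; rewrite gt_eqF.
by rewrite divr_ge0 ?sqr_ge0// mulr_ge0// ltW.
Qed.

Context (V : Type) (X : set V) (f : V -> S -> R) (G : R).
Context (fG : forall y s, X y -> `|f y s| <= G).
Implicit Types (U : set {ffun S -> R}).

Lemma worst_case_has_sup U y : U `<=` simplex R S -> U !=set0 -> X y ->
  has_sup [set expect p (f y) | p in U].
Proof.
move=> US [q Uq] Xy; split; first by exists (expect q (f y)), q.
exists G => _ [p Up <-]; apply: le_trans (ler_norm _) _.
by apply: expect_bound; [move=> s; exact: fG | exact: US].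
Qed.

(** Weak duality: the worst case over [U] dominates the expectation under [p]. The point [y] keeps
    the infimum from ranging over the empty set. *)
Lemma expect_le_robust_value U p y (a : R) : U `<=` simplex R S -> U p ->
  X y -> (forall y', X y' -> a <= expect p (f y')) -> a <= robust_value X f U.
Proof.
move=> US Up Xy ap; apply: lb_le_inf; first by exists (worst_case f U y), y.
move=> _ [y' Xy' <-]; apply: le_trans (ap y' Xy') _.
apply: sup_upper_bound; last by exists p.
by apply: worst_case_has_sup => //; exists p.
Qed.

Lemma dro_ogd_regret_bound s1 eta (U : nat -> set {ffun S -> R}) T
    (p : nat -> {ffun S -> R}) (x : nat -> V) (h : R) :
  (1 <= T)%N -> 0 < G -> (forall t, U t `<=` simplex R S) -> U T !=set0 ->
  (forall pp qq : nat -> {ffun S -> R},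
     (forall t, (1 <= t <= T)%N -> U t.-1 (pp t) /\ U t (qq t)) ->
     \sum_(1 <= t < T.+1) 1 / 2 * norm2 (pp t - qq t) ^+ 2 <= h) ->
  dro_ogd_run X f s1 eta U T p x ->
  \sum_(1 <= t < T.+1) (worst_case f (U t) (x t) - robust_value X f (U t))
    <= 2 * Num.sqrt (h * (T%:R * (G ^+ 2 * #|S|%:R / 2))) + 2 * G.
Proof.
move=> T1 G0 US UT drift [_ _ run].
have Up t : (1 <= t <= T)%N -> U t.-1 (p t) by move=> /run[[]].
have Xx t : (1 <= t <= T)%N -> X (x t) by move=> /run[_ []].
have xopt t y : (1 <= t <= T)%N -> X y ->
  expect (p t) (f (x t)) <= expect (p t) (f y) by move=> /run[_ [_ +]]; apply.
(* Before round [T] the next iterate [p t.+1] is a witness. *)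
have Une t : (1 <= t <= T)%N -> U t !=set0.
  move=> /andP[t1]; rewrite leq_eqVlt => /predU1P[->//|tT].
  by exists (p t.+1); apply: (Up t.+1).
(* [- G] replaces the missing play in round [T.+1]. *)
pose a t := if (t <= T)%N then expect (p t) (f (x t)) else - G.
have robust t : (1 <= t <= T)%N -> a t.+1 <= robust_value X f (U t).
  move=> t1T; have Xt := Xx t t1T; move: (t1T) => /andP[t1 tT]; rewrite /a.
  case: ltnP => [tT'|_].
    apply: (@expect_le_robust_value _ (p t.+1) (x t)) => //.
      exact: (Up t.+1).
    by move=> y Xy; apply: xopt.
  (* Here [t = T]: any feasible [q] gives expectations at least [- G]. *)
  have [q Uq] := Une t t1T.
  apply: (@expect_le_robust_value _ q (x t)) => // y Xy.
  have /ler_normlP[+ _] := @expect_bound _ G q (fun s => fG s Xy) (US _ _ Uq).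
  by rewrite lerNl.
(* Slack [e] avoids proving that the supremum is attained; a whole sequence is chosen because
   [drift] speaks of sequences. *)
have near_max e : 0 < e -> exists q : nat -> {ffun S -> R}, forall t,
    (1 <= t <= T)%N ->
    U t (q t) /\ worst_case f (U t) (x t) <= expect (q t) (f (x t)) + e.
  move=> e0; suff /choice[q qP] : forall t, exists q, (1 <= t <= T)%N ->
    U t q /\ worst_case f (U t) (x t) <= expect q (f (x t)) + e by exists q.
  move=> t.
  have [t1T|_] := boolP (1 <= t <= T)%N; last by exists (p t).
  have [_ [q Uq <-] le_q] := sup_adherent e0
    (worst_case_has_sup (US t) (Une t t1T) (Xx t t1T)).
  by exists q => _; split=> //; rewrite -lerBlDr ltW.
have split_bound e c : 0 < e -> 0 < c ->
    \sum_(1 <= t < T.+1) (worst_case f (U t) (x t) - robust_value X f (U t))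
      <= h / c + c * (T%:R * (G ^+ 2 * #|S|%:R / 2)) + 2 * G + T%:R * e.
  move=> e0 c0; have [q qP] := near_max e e0.
  set K := G ^+ 2 * #|S|%:R / 2.
  (* In each round the worst case is at most [expect (q t) (f (x t)) + e] and the robust value at
     least [a t.+1]; inserting [a t] leaves a Young term and a telescoping one. *)
  apply: (@le_trans _ _ (\sum_(1 <= t < T.+1)
    ((1 / 2 * norm2 (p t - q t) ^+ 2) / c + (c * K + e) - (a t.+1 - a t)))).
    apply: ler_sum_nat => t; rewrite ltnS => t1T.
    have [_ wq] := qP t t1T; have rv := robust t t1T.
    have Y := @expect_young _ _ (p t) (q t) _ c0 (fun s => fG s (Xx t t1T)).
    have aE : a t = expect (p t) (f (x t)) by case/andP: t1T => _; rewrite /a => ->.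
    by rewrite -/K in Y; lra.
  rewrite sumrB big_split/= -mulr_suml sumr_const_nat subn1/= telescope_sumr//.
  have hle : (\sum_(1 <= t < T.+1) 1 / 2 * norm2 (p t - q t) ^+ 2) / c <= h / c.
    rewrite ler_pM2r ?invr_gt0//; apply: drift => t t1T; split; first exact: Up.
    by have [] := qP t t1T.
  (* The end points of the telescoping sum account for [2 * G]. *)
  have a1 : a 1%N <= G.
    rewrite /a T1; apply: le_trans (ler_norm _) _; apply: expect_bound.
      by move=> s; apply/fG/Xx.
    by apply: (US 0%N); exact: (Up 1%N).
  have aT : a T.+1 = - G by rewrite /a ltnn.
  by rewrite aT -[(_ + e) *+ T]mulr_natl; lra.
have h0 : 0 <= h.
  have [q qP] := near_max 1 ltr01.
  apply: le_trans (drift p q _); last by move=> t t1T; split; [exact: Up|have [] := qP t t1T].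
  by apply: sumr_ge0 => t _; rewrite mulr_ge0 ?sqr_ge0.
have S0 : (0 < #|S|)%N by apply/card_gt0P; exists s1.
rewrite -lerBlDr; apply: ler_double_sqrt => //.
  by rewrite !mulr_gt0 ?ltr0n ?exprn_gt0.
move=> c c0; apply/ler_addgt0Pr => e e0.
(* Slack [e / T%:R] per round adds up to [e]. *)
have T0 : 0 < (T%:R : R) by rewrite ltr0n.
have := split_bound (e / T%:R) c (divr_gt0 e0 T0) c0.
by rewrite [T%:R * (e / _)]mulrC divfK ?gt_eqF//; lra.
Qed.

End Regret.

(** * Transfer to the probability space *)

Theorem theorem3p1 (R : realType) (d : measure_display)
    (Omega : measurableType d) (P : probability Omega R)
    (S : finType) (s1 : S) (V : Type) (X : set V) (f : V -> S -> R)
    (pstar : {ffun S -> R}) (xi : nat -> Omega -> S)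
    (k : ambiguity_type R S) (T : nat) (delta G : R) (h : nat -> R)
    (p : Omega -> nat -> {ffun S -> R}) (x : Omega -> nat -> V) :
  let U := fun w => ambiguity k delta (xi ^~ w) in
  let eta := Num.sqrt (2 * h T / (G ^+ 2 * T%:R * #|S|%:R)) in
  (1 <= T)%N ->
  0 < delta < 1 ->
  wf_ambiguity_type k ->
  simplex R S pstar ->
  iid_from P pstar xi ->
  (forall t, (1 <= t)%N ->
     with_prob_ge P (1 - conf_level delta t) [set w | U w t pstar]) ->
  0 < G ->
  (forall y s, X y -> `|f y s| <= G) ->
  (forall w t, (1 <= t <= T)%N ->
     exists y, is_argmin X (worst_case f (U w t)) y) ->
  with_prob_ge P (1 - delta)
    [set w | forall pp qq : nat -> {ffun S -> R},
       (forall t, (1 <= t <= T)%N -> U w t.-1 (pp t) /\ U w t (qq t)) ->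
       \sum_(1 <= t < T.+1) 1 / 2 * norm2 (pp t - qq t) ^+ 2 <= h T] ->
  (forall w, dro_ogd_run X f s1 eta (U w) T (p w) (x w)) ->
  with_prob_ge P (1 - delta)
    [set w | 1 / T%:R *
       (\sum_(1 <= t < T.+1)
          (worst_case f (U w t) (x w t) - robust_value X f (U w t)))
       <= G * Num.sqrt (2 * #|S|%:R * h T / T%:R) + 2 * G / T%:R].
Proof.
move=> U eta T1 delta01 wfk _ _ pstar_in G0 fG _ [E [mE Edrift PE]] run.
have [w0 UT0] : [set w | U w T pstar] !=set0.
  apply: with_prob_ge_nonempty (pstar_in T T1).
  by rewrite subr_gt0 conf_level_lt1.
(* The event of the drift bound serves unchanged: the path [w0] is used only for the sign of the
   width, so no further probability is lost. *)
exists E; split=> // w Ew /=.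
have US t : U w t `<=` simplex R S by exact: ambiguity_simplex.
have UT : U w T !=set0.
  exists (empirical R (xi ^~ w) T).
  by apply: (empirical_ambiguity (obs' := xi ^~ w0) _ s1) => //; exists pstar.
have T0 : 0 < (T%:R : R) by rewrite ltr0n.
rewrite mul1r mulrC ler_pdivrMr//.
apply: le_trans (dro_ogd_regret_bound fG T1 G0 US UT (Edrift w Ew) (run w)) _.
rewrite [leRHS]mulrDl divfK ?gt_eqF// lerD2r le_eqVlt; apply/orP; left; apply/eqP.
(* After multiplication by [T] both sides agree once [G * T%:R / 2] is pulled out of the root. *)
have -> : h T * (T%:R * (G ^+ 2 * #|S|%:R / 2)) =
    (G * T%:R / 2) ^+ 2 * (2 * #|S|%:R * h T / T%:R).
  by field; rewrite gt_eqF.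
rewrite sqrtrM ?sqr_ge0// sqrtr_sqr ger0_norm; last first.
  by rewrite !mulr_ge0// ltW.
by field.
Qed.
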